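(* Let $(G,\sigma)$ be a signed graph whose underlying graph $G$ has treewidth at most $2$. Then $\chi\big(\hat{G}^{[\sharp -2]}_{\mathrm{strong}}\big)\le 7$, where $\hat{G}^{[\sharp -2]}_{\mathrm{strong}}$ denotes the strong exact-distance $-2$ graph of $(G,\sigma)$.
   Context: A signed graph $(G,\sigma)$ is a (finite, simple) graph $G$ together with a signature $\sigma:E(G)\to\{+,-\}$. The sign of a path is the product of the signs of its edges; a path is negative if its sign is $-$. $d(x,y)$ is the distance in $G$. For a positive integer $k$, the strong exact-distance $-k$ graph of $(G,\sigma)$ is the (unsigned) graph with vertex set $V(G)$ in which $xy$ is an edge if and only if $d(x,y)=k$ and some $xy$-path of length $k$ is negative in $(G,\sigma)$. The treewidth of $G$ is the least $t$ such that $G$ is a subgraph of a $t$-tree, where a $t$-tree is either a clique on $t+1$ vertices or is obtained from a smaller $t$-tree by adding a vertex adjacent to $t$ pairwise adjacent vertices. *)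

(* Defs.v *)
From mathcomp Require Import boolp.
From mathcomp Require Import all_boot.

Set Implicit Arguments.
Unset Strict Implicit.
Unset Printing Implicit Defensive.

Record sgraph := SGraph {
  vertex :> finType;
  adj : rel vertex;
  adj_sym : symmetric adj;
  adj_irrefl : irreflexive adj }.

Definition clique (G : sgraph) (A : {set G}) : bool :=
  [forall x in A, forall y in A, (x != y) ==> adj x y].

(* [ktree_on t A] says that the subgraph of [G] induced by [A] is a t-tree. *)
Inductive ktree_on (t : nat) (G : sgraph) : {set G} -> Prop :=
| ktree_clique (A : {set G}) :
    #|A| = t.+1 -> clique A -> ktree_on t A
| ktree_add (A : {set G}) (v : G) :
    ktree_on t A -> v \notin A ->
    #|[set x in A | adj v x]| = t -> clique [set x in A | adj v x] ->
    ktree_on t (v |: A).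

Definition ktree (t : nat) (G : sgraph) : Prop := ktree_on t [set: G].

(* Up to isomorphism; not necessarily induced. *)
Definition subgraph (G H : sgraph) : Prop :=
  exists2 f : G -> H, injective f & forall x y, adj x y -> adj (f x) (f y).

Definition partial_ktree (t : nat) (G : sgraph) : Prop :=
  exists2 H : sgraph, ktree t H & subgraph G H.

Definition complete (V : finType) : sgraph.
Proof.
apply: (@SGraph V (fun x y => x != y)) => [x y|x]; first by rewrite eq_sym.
by rewrite eqxx.
Defined.

Lemma partial_ktree_ex (G : sgraph) : exists t, `[< partial_ktree t G >].
Proof.
exists #|G|; apply/asboolP; exists (complete (option G)).
  apply: ktree_clique; first by rewrite cardsT card_option.
  by apply/forall_inP => x _; apply/forall_inP => y _; apply/implyP.
exists Some => [x y []//|x y xy]; apply/eqP => -[exy].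
by rewrite exy adj_irrefl in xy.
Qed.

Definition treewidth (G : sgraph) : nat := ex_minn (partial_ktree_ex G).

Definition colorable (k : nat) (G : sgraph) : bool :=
  [exists c : {ffun G -> 'I_k}, forall x, forall y, adj x y ==> (c x != c y)].

Lemma colorable_ex (G : sgraph) : exists k, colorable k G.
Proof.
exists #|G|; apply/existsP; exists [ffun x => enum_rank x].
apply/forallP => x; apply/forallP => y; apply/implyP => xy.
rewrite !ffunE; apply/eqP => /enum_rank_inj exy.
by rewrite exy adj_irrefl in xy.
Qed.

Definition chromatic_number (G : sgraph) : nat := ex_minn (colorable_ex G).

(* An xy-path is represented by the list [p] of its vertices other than the
   starting point [x]; its length is [size p]. *)
Definition is_path (G : sgraph) (x y : G) (p : seq G) : bool :=
  [&& path (@adj G) x p, last x p == y & uniq (x :: p)].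

Definition has_path (G : sgraph) (x y : G) (k : nat) : bool :=
  [exists p : k.-tuple G, is_path x y p].

(* The length of a shortest xy-path, and [None] if [x] and [y] lie in different
   components; a path has fewer than [#|G|] edges. *)
Definition dist (G : sgraph) (x y : G) : option nat :=
  ohead [seq k <- iota 0 #|G| | has_path x y k].

(* A sign is a boolean, [true] standing for -, so that the product of signs is
   [addb]. The edge xy is the set [set x; y]; the values of a signature on sets
   that are not edges are never used. *)
Definition signature (G : sgraph) : Type := {set G} -> bool.

Definition path_sign (G : sgraph) (sigma : signature G) (x : G) (p : seq G) :
    bool :=
  \big[addb/false]_(s <- pairmap (fun u v => [set u; v]) x p) sigma s.

Definition strong_adj (k : nat) (G : sgraph) (sigma : signature G) : rel G :=
  fun x y => (dist x y == Some k) &&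
    [exists p : k.-tuple G, is_path x y p && path_sign sigma x p].

Lemma is_path_rev (G : sgraph) (x y : G) (p : seq G) :
  is_path x y p -> is_path y x (rev (belast x p)).
Proof.
case/and3P => xp /eqP <- up; apply/and3P; split.
- by rewrite rev_path (eq_path (e' := @adj G)) // => u v; rewrite adj_sym.
- by case: p {xp up} => //= z p; rewrite rev_cons last_rcons.
- by rewrite -rev_rcons -lastI rev_uniq.
Qed.

Lemma path_sign_rev (G : sgraph) (sigma : signature G) (x : G) (p : seq G) :
  path_sign sigma (last x p) (rev (belast x p)) = path_sign sigma x p.
Proof.
rewrite /path_sign; elim: p x => [|y p IHp] x /=; first by rewrite !big_nil.
rewrite rev_cons -cats1 pairmap_cat big_cat /= IHp big_seq1 big_cons addbC.
congr (sigma _ (+) _); rewrite setUC; congr (_ :|: [set _]).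
by case: p {IHp} => //= z p; rewrite rev_cons last_rcons.
Qed.

Lemma has_path_sym (G : sgraph) (x y : G) (k : nat) :
  has_path x y k = has_path y x k.
Proof.
suff imp (u v : G) : has_path u v k -> has_path v u k by apply/idP/idP; exact: imp.
move=> /existsP[p up]; apply/existsP.
have sz : size (rev (belast u p)) == k by rewrite size_rev size_belast size_tuple.
by exists (Tuple sz); exact: is_path_rev.
Qed.

Lemma strong_adj_sym (k : nat) (G : sgraph) (sigma : signature G) :
  symmetric (strong_adj k sigma).
Proof.
move=> x y; rewrite /strong_adj; congr (_ && _).
  by rewrite /dist (eq_filter (a2 := has_path y x)) // => j; exact: has_path_sym.
suff imp (u v : G) : [exists p : k.-tuple G, is_path u v p && path_sign sigma u p] ->
    [exists p : k.-tuple G, is_path v u p && path_sign sigma v p].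
  by apply/idP/idP; exact: imp.
move=> /existsP[p /andP[up sp]]; apply/existsP.
have sz : size (rev (belast u p)) == k by rewrite size_rev size_belast size_tuple.
exists (Tuple sz); rewrite is_path_rev //=.
by case/and3P: up => _ /eqP <- _; rewrite path_sign_rev.
Qed.

Lemma strong_adj_irrefl (k : nat) (G : sgraph) (sigma : signature G) :
  irreflexive (strong_adj k sigma).
Proof.
move=> x; apply/negP => /andP[_ /existsP[p /andP[/and3P[_ /eqP lp up]]]].
case: (val p) lp up => [|y q] /= lp up; first by rewrite /path_sign big_nil.
by case/andP: up; rewrite -{1}lp mem_last.
Qed.

Definition strong_exact_distance_graph (k : nat) (G : sgraph)
    (sigma : signature G) : sgraph :=
  SGraph (strong_adj_sym k sigma) (strong_adj_irrefl k sigma).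

(* Main.v *)
Require Import Defs.
From mathcomp Require Import all_boot.

Set Implicit Arguments.
Unset Strict Implicit.
Unset Printing Implicit Defensive.

(** A vertex is labelled by a word of length 7 with one hole, three + and three
-; its colour is the position of the hole. The word of y prescribes the signs
of the edges from y to its neighbours of each colour, so the two ends of a
negative path of length 2 through y get distinct colours. Adjacent words are
moreover required to show all four pairs of signs outside their two holes:
then a vertex joined to both by edges of any given signs can be labelled, and
the labelling is built along the construction of the 2-tree. *)

Implicit Types (s : bool) (a b w : seq (option bool)).

Definition balanced_word : seq (option bool) :=
  [:: None; Some true; Some true; Some true; Some false; Some false; Some false].

(* The pairs of letters at the seven positions of adjacent words: as both words
   have three + and three -, it must be (~~ s, ~~ s) that occurs twice. *)
Definition edge_columns s : seq (option bool * option bool) :=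
  [:: (None, Some s); (Some s, None); (Some s, Some s); (Some s, Some (~~ s));
      (Some (~~ s), Some s); (Some (~~ s), Some (~~ s));
      (Some (~~ s), Some (~~ s))].

(** [zip] truncates to the shorter word, hence the separate condition on the lengths. *)
Definition compatible s a b : bool :=
  (size a == size b) && perm_eq (zip a b) (edge_columns s).

Lemma compatible_sym s a b : compatible s a b = compatible s b a.
Proof.
suff imp a' b' : compatible s a' b' -> compatible s b' a' by apply/idP/idP; exact: imp.
case/andP=> /eqP sz /(perm_map (fun c => (c.2, c.1))) ab.
rewrite /compatible sz eqxx /=.
have -> : zip b' a' = [seq (c.2, c.1) | c <- zip a' b'].
  by elim: a' b' sz {ab} => [|x a' IH] [|y b'] //= [/IH ->].
by apply: perm_trans ab _; case: s.
Qed.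

Lemma compatible_balanced s a b :
  compatible s a b -> perm_eq a balanced_word.
Proof.
case/andP=> /eqP sz /(perm_map fst).
rewrite -/(unzip1 _) unzip1_zip ?sz // => /perm_trans; apply.
by case: s.
Qed.

(** The only column of [edge_columns s] with [None] in second place is [(Some s, None)]. Thus a word
    records the edge sign at the hole of its neighbour. *)
Lemma compatible_nth s a b :
  compatible s a b -> nth None a (index None b) = Some s.
Proof.
case/andP=> /eqP sz ab.
have hole : None \in b.
  rewrite -(@unzip2_zip _ _ a b) ?sz // (perm_mem (perm_map snd ab)).
  by case: s {ab}.
have := mem_nth (None, None) (s := zip a b) (n := index None b).
rewrite size_zip sz minnn index_mem hole => /(_ isT).
rewrite nth_zip // nth_index // (perm_mem ab) !inE !xpair_eqE !andbF !orbF.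
by rewrite andbT => /eqP.
Qed.

(** Used to reorder a table of columns so that its known rows become given words; the remaining row
    is then the new word. *)
Lemma perm_map_lift (T1 T2 : eqType) (h : T1 -> T2) (r : seq T2) (t : seq T1) :
  perm_eq r (map h t) -> exists2 t', perm_eq t' t & r = map h t'.
Proof.
case: t => [|x0 t]; first by move/perm_nilP=> ->; exists [::].
set u := x0 :: t => /(perm_iotaP (h x0))[Is pIs ->].
exists (map (nth x0 u) Is).
  by apply/(perm_iotaP x0); exists Is; rewrite // -(size_map h).
rewrite -map_comp; apply/eq_in_map => i.
by rewrite (perm_mem pIs) mem_iota size_map => /andP[_ iu]; rewrite (nth_map x0).
Qed.

Lemma extend_vertex s a :
  perm_eq a balanced_word -> exists w, compatible s a w.
Proof.
move=> bal; have: perm_eq a (unzip1 (edge_columns s)).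
  by apply: perm_trans bal _; case: s.
case/perm_map_lift => t pt ->; exists (unzip2 t).
by rewrite /compatible !size_map eqxx zip_unzip.
Qed.

(* [m] is the majority among [s], [s1], [s2]. *)
Definition triangle_columns s s1 s2 : seq (option bool * option bool * option bool) :=
  let m := if s == s1 then s else s2 in
  [:: (None, Some s, Some s1); (Some s, None, Some s2); (Some s1, Some s2, None);
      (Some m, Some (~~ s2), Some (~~ s2)); (Some (~~ s1), Some m, Some (~~ s1));
      (Some (~~ s), Some (~~ s), Some m); (Some (~~ m), Some (~~ m), Some (~~ m))].

(** In all eight sign cases, the three pairs of rows of [triangle_columns s s1 s2] are
    rearrangements of [edge_columns] for [s], [s1] and [s2]. Once the first two rows are matched
    with [a] and [b], the third is [w]. *)
Lemma extend_edge s s1 s2 a b :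
  compatible s a b -> exists2 w, compatible s1 a w & compatible s2 b w.
Proof.
case/andP=> /eqP sz ab; pose T := triangle_columns s s1 s2.
have: perm_eq (zip a b) (unzip1 T).
  by apply: perm_trans ab _; rewrite /T; case: s {T}; case: s1; case: s2.
case/perm_map_lift => t pt abt; exists (unzip2 t).
  have -> : a = [seq c.1.1 | c <- t].
    by rewrite -(@unzip1_zip _ _ a b) ?sz // abt /unzip1 -!map_comp.
  rewrite /compatible !size_map eqxx zip_map.
  by apply: perm_trans (perm_map _ pt) _; rewrite /T; case: s {ab T pt}; case: s1; case: s2.
have -> : b = [seq c.1.2 | c <- t].
  by rewrite -(@unzip2_zip _ _ a b) ?sz // abt /unzip1 /unzip2 -!map_comp.
rewrite /compatible !size_map eqxx zip_map.
by apply: perm_trans (perm_map _ pt) _; rewrite /T; case: s {ab T pt}; case: s1; case: s2.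
Qed.

Definition labelling (G : sgraph) (sigma : signature G) (A : {set G})
    (W : G -> seq (option bool)) : Prop :=
  {in A, forall x, perm_eq (W x) balanced_word} /\
  {in A &, forall x y, adj x y -> compatible (sigma [set x; y]) (W x) (W y)}.

Lemma extend_clique (G : sgraph) (sigma : signature G) (K : {set G}) W (tau : G -> bool) :
  labelling sigma K W -> clique K -> #|K| <= 2 ->
  exists2 w, perm_eq w balanced_word & {in K, forall x, compatible (tau x) (W x) w}.
Proof.
case=> bal cmp /forall_inP cl; case: (posnP #|K|) => [/eqP|].
  by rewrite cards_eq0 => /eqP->; exists balanced_word => // x; rewrite inE.
rewrite leq_eqVlt => /predU1P[/esym/eqP/cards1P[x defK] _|gt1 le2].
  have xK : x \in K by rewrite defK inE.
  have [w xw] := extend_vertex (tau x) (bal x xK).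
  exists w; first by apply: (@compatible_balanced (tau x) w (W x)); rewrite compatible_sym.
  by move=> z; rewrite defK inE => /eqP->.
have /cards2P[x [y [xy defK]]] : #|K| == 2 by rewrite eqn_leq le2.
have [xK yK] : x \in K /\ y \in K by rewrite defK !inE !eqxx orbT.
have axy : adj x y by have /forall_inP/(_ y yK) := cl x xK; rewrite xy.
have [w xw yw] := extend_edge (tau x) (tau y) (cmp x y xK yK axy).
exists w; first by apply: (@compatible_balanced (tau x) w (W x)); rewrite compatible_sym.
by move=> z; rewrite defK !inE => /orP[]/eqP->.
Qed.

(** Only the neighbours of [v] in [A] constrain its word, and [extend_clique] serves them all at
    once. *)
Lemma labelling_add (G : sgraph) (sigma : signature G) (A : {set G}) (v : G) W :
  labelling sigma A W -> v \notin A ->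
  #|[set x in A | adj v x]| <= 2 -> clique [set x in A | adj v x] ->
  exists W', labelling sigma (v |: A) W'.
Proof.
move=> lab vA; set K := [set x in A | adj v x] => cardK clK.
have subK : {subset K <= A} by move=> x; rewrite inE => /andP[].
have labK : labelling sigma K W.
  case: lab => bal cmp; split=> [x /subK|x y /subK xA /subK yA]; [exact: bal | exact: cmp].
have [w balw cw] := extend_clique (fun x => sigma [set x; v]) labK clK cardK.
case: lab => bal cmp; exists (fun x => if x == v then w else W x).
have neq x : x \in A -> x == v = false by move=> xA; apply: contraNF vA => /eqP <-.
split=> [x /setU1P[->|xA]|x y /setU1P[->|xA] /setU1P[->|yA]].
- by rewrite eqxx.
- by rewrite neq //; exact: bal.
- by rewrite adj_irrefl.
- rewrite eqxx neq // => vy; rewrite compatible_sym setUC.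
  by apply: cw; rewrite inE yA.
- rewrite eqxx neq // => xv.
  by apply: cw; rewrite inE xA adj_sym.
- by rewrite !neq //; exact: cmp.
Qed.

(** Vertices are added one at a time, each with at most two earlier neighbours. *)
Lemma labelling_clique (G : sgraph) (sigma : signature G) (A : {set G}) :
  #|A| <= 3 -> clique A -> exists W, labelling sigma A W.
Proof.
have [n] := ubnP #|A|; elim: n A => // n IHn A /[!ltnS] An A3 clA.
have [->|[v vA]] := set_0Vmem A.
  by exists (fun=> [::]); split=> x; rewrite inE.
have clS (B : {set G}) : B \subset A -> clique B.
  move/subsetP=> BA; apply/forall_inP => x /BA xA; apply/forall_inP => y /BA yA.
  by have /forall_inP/(_ x xA)/forall_inP := clA; apply.
have cardA := cardsD1 v A; rewrite vA add1n in cardA.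
have [W lab] : exists W, labelling sigma (A :\ v) W.
  by apply: IHn; [rewrite -cardA | rewrite ltnW // -cardA | apply: clS; exact: subD1set].
have subK : [set x in A :\ v | adj v x] \subset A :\ v.
  by apply/subsetP => x; rewrite inE => /andP[].
rewrite -(setD1K vA); apply: labelling_add lab _ _ _.
- by rewrite !inE eqxx.
- by rewrite (leq_trans (subset_leq_card subK)) // -ltnS -cardA.
- by apply: clS; apply: subset_trans subK (subD1set _ _).
Qed.

Lemma labelling_ktree (t : nat) (H : sgraph) (sigma : signature H) (A : {set H}) :
  t <= 2 -> ktree_on t A -> exists W, labelling sigma A W.
Proof.
move=> t2; elim=> [B cardB|B v _ [W lab] vB cardK clK].
  by apply: labelling_clique; rewrite cardB.
by apply: labelling_add lab vB _ clK; rewrite cardK.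
Qed.

Lemma strong_adj2P (G : sgraph) (sigma : signature G) (x z : G) :
  strong_adj 2 sigma x z ->
  exists y, [/\ adj x y, adj y z & sigma [set x; y] != sigma [set y; z]].
Proof.
case/andP=> _ /existsP[[[|y [|z' [|? ?]]] //= sz]] /andP[/and3P[/= ]].
rewrite andbT => /andP[xy yz'] /eqP <- _ sgn; exists y; split=> //.
by move: sgn; rewrite /path_sign /= !big_cons big_nil addbF; do 2!case: (sigma _).
Qed.

Theorem theorem5 (G : sgraph) (sigma : signature G) :
  treewidth G <= 2 ->
  chromatic_number (strong_exact_distance_graph 2 sigma) <= 7.
Proof.
rewrite /treewidth; case: ex_minnP => t /boolp.asboolP[H treeH [f f_inj f_adj]] _ t2.
(* The t-tree [H] is signed by pulling sets back along [f]: images of edges of [G] keep their signs,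
   and the signs of other edges of [H] are arbitrary. *)
have [W [bal cmp]] := labelling_ktree (fun S => sigma (f @^-1: S)) t2 treeH.
have Wadj x y : adj x y -> compatible (sigma [set x; y]) (W (f x)) (W (f y)).
  move=> xy; have -> : [set x; y] = f @^-1: [set f x; f y].
    by apply/setP => u; rewrite !inE !(inj_eq f_inj).
  by apply: cmp; rewrite ?inE // f_adj.
have hole_lt x : index None (W (f x)) < 7.
  have balx := bal (f x) (in_setT _).
  by rewrite -[7]/(size balanced_word) -(perm_size balx) index_mem (perm_mem balx).
rewrite /chromatic_number; case: ex_minnP => k _; apply.
apply/existsP; exists [ffun x => Ordinal (hole_lt x)].
apply/forallP => x; apply/forallP => z; apply/implyP => /strong_adj2P[y [xy yz sgn]].
(* If [x] and [z] share a hole, the letter of [W (f y)] there is the sign of both edges at [y], so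
   these signs agree. *)
rewrite !ffunE; apply: contraNneq sgn => -[hole].
have yx : adj y x by rewrite adj_sym.
have := compatible_nth (Wadj y x yx).
by rewrite hole (compatible_nth (Wadj y z yz)) (setUC [set x]) => -[->].
Qed.
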